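(* There is an absolute constant $C>0$ such that for every integer $n\ge 2$, the SoS rank of the Set Cover instance $$\min \sum_{i\in[n]} x_i\quad\text{s.t.}\quad \sum_{i\in[n]\setminus\{j\}}x_i\ge 1\ \ \forall j\in[n],\quad \mathbf{x}\in\{0,1\}^n$$ is at most $C\sqrt{n}\log(n)$, i.e. it is $O(\sqrt{n}\log n)$.
   Context: For $n\in\mathbb{N}$, $\Sigma_{n,d}$ is the set of finite sums $\sum_i s_i^2$ of squares of real polynomials in $x_1,\dots,x_n$ of degree at most $d$. Let $\mathcal{H}=\{\pm(x_i^2-x_i): i\in[n]\}$. For a finite set $\mathcal{G}\supseteq\mathcal{H}$ of polynomials, $\Sigma^{\mathcal{G}}_{n,d}$ is the set of polynomials $s_0+\sum_i s_i g_i$ (finite sum) with $g_i\in\mathcal{G}$, $s_i\in\Sigma_{n,d}$, $s_0\in\Sigma_{n,2\lceil(2d+\deg(\mathcal{G}))/2\rceil}$, where $\deg(\mathcal{G})$ is the maximum degree of an element of $\mathcal{G}$. For an objective $f$ and constraint set $\mathcal{G}$, let $\mathcal{G}_+=\{\mathbf{x}\in\mathbb{R}^n: g(\mathbf{x})\ge0\ \forall g\in\mathcal{G}\}$, $f^*=\min\{f(\mathbf{x}):\mathbf{x}\in\mathcal{G}_+\}$, and $f^d_\Sigma=\max\{\lambda\in\mathbb{R}: f-\lambda\in\Sigma^{\mathcal{G}}_{n,d}\}$. The SoS rank is the smallest $d$ with $f^d_\Sigma=f^*$. For the Set Cover instance, $f=\sum_i x_i$ and $\mathcal{G}=\mathcal{H}\cup\{\sum_{i\in[n]\setminus\{j\}}x_i-1: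 j\in[n]\}$. *)

(* Defs.v *)
From HB Require Import structures.
From mathcomp Require Import all_boot all_order all_algebra.
From mathcomp Require Import reals.
From mathcomp Require Import mpoly.
(* exp is not imported: notations loaded by mathcomp-analysis clash with those
   of mpoly. *)
From mathcomp Require exp.

Set Implicit Arguments.
Unset Strict Implicit.
Unset Printing Implicit Defensive.

Import Order.TTheory GRing.Theory Num.Theory.
Local Open Scope ring_scope.

Section SumOfSquares.
Variables (R : realType) (n : nat).
Implicit Types (f p : {mpoly R[n]}) (G : seq {mpoly R[n]}).

(* The degree bound is on the polynomials being squared: deg q <= d, i.e.
   msize q <= d + 1 (which also admits q = 0). *)
Definition in_Sigma (d : nat) p : Prop :=
  exists qs : seq {mpoly R[n]},
    (forall q, q \in qs -> (msize q <= d.+1)%N) /\ p = \sum_(q <- qs) q ^+ 2.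

Definition deg_seq G : nat := \max_(g <- G) (msize g).-1.

(* uphalf k is the ceiling of k / 2. *)
Definition in_SigmaG G (d : nat) p : Prop :=
  exists (s0 : {mpoly R[n]}) (sg : seq ({mpoly R[n]} * {mpoly R[n]})),
    [/\ in_Sigma (2 * uphalf (2 * d + deg_seq G)) s0,
        forall t, t \in sg -> in_Sigma d t.1 /\ t.2 \in G
      & p = s0 + \sum_(t <- sg) t.1 * t.2].

Definition feasible G (x : 'I_n -> R) : Prop :=
  forall g, g \in G -> 0 <= g.@[x].

Definition is_min (A : R -> Prop) (v : R) : Prop :=
  A v /\ forall w, A w -> v <= w.

Definition is_max (A : R -> Prop) (v : R) : Prop :=
  A v /\ forall w, A w -> w <= v.

Definition is_opt f G (v : R) : Prop :=
  is_min (fun w => exists2 x, feasible G x & w = f.@[x]) v.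

Definition is_sos_opt f G (d : nat) (v : R) : Prop :=
  is_max (fun lambda => in_SigmaG G d (f - lambda%:MP)) v.

(* Both optima are required to exist (be attained) and to coincide. *)
Definition sos_exact f G (d : nat) : Prop :=
  exists2 v, is_opt f G v & is_sos_opt f G d v.

Definition is_sos_rank f G (r : nat) : Prop :=
  sos_exact f G r /\ forall d, sos_exact f G d -> (r <= d)%N.

End SumOfSquares.

Definition boolean_constraints (R : realType) (n : nat) : seq {mpoly R[n]} :=
  [seq 'X_i ^+ 2 - 'X_i | i : 'I_n] ++ [seq - ('X_i ^+ 2 - 'X_i) | i : 'I_n].

Definition set_cover_constraints (R : realType) (n : nat) : seq {mpoly R[n]} :=
  boolean_constraints R n
    ++ [seq \sum_(i < n | i != j) 'X_i - 1 | j : 'I_n].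

Definition set_cover_objective (R : realType) (n : nat) : {mpoly R[n]} :=
  \sum_(i < n) 'X_i.

(* Main.v *)
Require Import Defs.
From mathcomp Require Import all_boot all_order all_algebra.
From mathcomp Require Import reals.
From mathcomp Require exp.
From mathcomp Require boolp.
From mathcomp Require Import complex polyrcf mpoly ring lra zify.

Set Implicit Arguments.
Unset Strict Implicit.
Unset Printing Implicit Defensive.

Import Order.TTheory GRing.Theory Num.Theory.
Local Open Scope ring_scope.

(* Write S for the sum of the x_j and take the multipliers
   x_j^2 A(S) + (1 - x_j)^2 (S - 2)^2 h(S)^2.  Modulo x_j^2 = x_j, their products
   with S - x_j - 1 add up to (S - 2) (S A + (n - S) (S - 1) (S - 2) h^2), so that
   S - 2 is certified (with s_0 = 0) as soon as the univariate polynomial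
   A = (1 - (n - t) (t - 1) (t - 2) h^2) / t is a sum of squares, i.e.
   nonnegative.  This requires 2 n h(0)^2 = 1 while n t^2 h(t)^2 stays bounded on
   [2, n]: h is the square of a rescaled Chebyshev polynomial of the second kind,
   whose degree m - 1 only needs m^2 >= n.  The resulting rank bound is O(sqrt n). *)

(** * Nonnegative univariate polynomials as sums of squares *)

Section UnivariateSumOfSquares.
Variable R : rcfType.
Implicit Types (p q r : {poly R}) (u v : R).

Lemma horner_ge0_limit p u :
  (forall e, 0 < e -> exists2 y, `|y - u| < e & 0 <= p.[y]) -> 0 <= p.[u].
Proof.
move=> near_u; rewrite leNgt; apply/negP => pu_lt0.
have npu_gt0 : 0 < - p.[u] by rewrite oppr_gt0.
have [e e_gt0 cont_p] := poly_cont u p npu_gt0.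
have [y yu py_ge0] := near_u _ e_gt0.
have := cont_p _ yu; rewrite ltr_norml => /andP[_]; lra.
Qed.

(** Writing p = r ('X - u), the cofactor [r] is nonpositive to the left of [u] and nonnegative to
    the right, so by continuity it vanishes at [u]. *)
Lemma ge0_poly_double_root p u :
  (forall x, 0 <= p.[x]) -> root p u -> ('X - u%:P) ^+ 2 %| p.
Proof.
move=> p_ge0; rewrite root_factor_theorem => /dvdpP[r p_def].
have pE x : p.[x] = r.[x] * (x - u) by rewrite p_def !hornerE.
suff ru : r.[u] = 0.
  have /dvdpP[q r_def] : 'X - u%:P %| r by rewrite -root_factor_theorem /root ru.
  by apply/dvdpP; exists q; rewrite p_def r_def expr2 mulrA.
apply/eqP; rewrite eq_le -oppr_ge0 -hornerN; apply/andP; split;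
  apply: horner_ge0_limit => e e_gt0.
- exists (u - e / 2).
    by rewrite addrAC subrr add0r normrN gtr0_norm; lra.
  by move: (p_ge0 (u - e / 2)); rewrite pE hornerN; nra.
- exists (u + e / 2).
    by rewrite addrAC subrr add0r gtr0_norm; lra.
  by move: (p_ge0 (u + e / 2)); rewrite pE; nra.
Qed.

(** A complex root u + iv exists by algebraic closure. If v = 0 it is a real root, hence a double
    one; otherwise the remainder modulo the quadratic is affine with real coefficients and vanishes
    at a nonreal point, so it is zero. *)
Lemma ge0_poly_quadratic_factor p :
  (1 < size p)%N -> (forall x, 0 <= p.[x]) ->
  exists u v, ('X - u%:P) ^+ 2 + (v ^+ 2)%:P %| p.
Proof.
move=> p_gt1 p_ge0.
have /closed_rootP[[u v]] : size (map_poly (real_complex R) p) != 1%N.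
  by rewrite size_map_poly; case: (size p) p_gt1 => [|[]].
have [->|v_neq0] := eqVneq v 0; [|set z := (u +i* v)%C] => pz.
  exists u, 0; rewrite expr0n /= addr0; apply: ge0_poly_double_root => //.
  by move: pz; rewrite (fmorph_root (real_complex R)).
exists u, v; set d := (_ + _).
have d_size : size d = 3%N.
  rewrite size_polyDl size_exp_XsubC // size_polyC.
  by case: eqP.
have d_neq0 : d != 0 by rewrite -size_poly_eq0 d_size.
have dz : (map_poly (real_complex R) d).[z] = 0.
  rewrite /d rmorphD rmorphXn rmorphB /= map_polyX !map_polyC !hornerE /=.
  by apply/eqP; rewrite eq_complex /=; apply/andP; split; apply/eqP; ring.
have r_size : (size (p %% d)%R <= 2)%N by rewrite -ltnS -d_size ltn_modp.
have rE : p %% d = ((p %% d)`_1)%:P * 'X + ((p %% d)`_0)%:P.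
  apply/polyP => i; rewrite coefD coefMX coefC coefC.
  case: i => [|[|i]] //=; rewrite ?add0r ?addr0 // nth_default //.
  exact: leq_trans r_size _.
have : (map_poly (real_complex R) (p %% d)).[z] == 0.
  move: pz; rewrite /root {1}(divp_eq p d) rmorphD rmorphM /= hornerD hornerM.
  by rewrite dz mulr0 add0r.
rewrite rE rmorphD rmorphM /= map_polyX !map_polyC !hornerE.
rewrite eq_complex /= !mul0r subr0 !addr0 => /andP[/eqP re /eqP im].
move/eqP: im; rewrite mulf_eq0 (negPf v_neq0) orbF => /eqP r1.
move: re; rewrite r1 mul0r add0r => r0.
by rewrite /dvdp rE r1 r0 mul0r addr0.
Qed.

(** Induction on the size, splitting off one quadratic factor at a time: (('X - u)^2 + v^2) r^2 =
    (('X - u) r)^2 + (v r)^2. The size bound says that each square has degree at most that of [p]: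
    no leading terms cancel. *)
Lemma ge0_poly_sum_squares p :
  (forall x, 0 <= p.[x]) ->
  exists qs : seq {poly R},
    (forall q, q \in qs -> ((size q).*2 <= (size p).+1)%N) /\
    p = \sum_(q <- qs) q ^+ 2.
Proof.
have [k] := ubnP (size p); elim: k p => // k IHk p p_lek p_ge0.
have [p_le1|p_gt1] := leqP (size p) 1.
  have [c c_def] : exists c, p = c%:P by exists p`_0; apply: size1_polyC.
  have c_ge0 : 0 <= c by move: (p_ge0 0); rewrite c_def hornerC.
  have [c0|c_neq0] := eqVneq c 0.
    by exists [::]; split=> //; rewrite big_nil c_def c0.
  exists [:: (Num.sqrt c)%:P]; split.
    move=> q; rewrite inE => /eqP->; rewrite c_def !size_polyC c_neq0.
    by case: eqP.
  by rewrite big_seq1 -polyC_exp sqr_sqrtr.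
have [u [v /dvdpP[q p_def]]] := ge0_poly_quadratic_factor p_gt1 p_ge0.
set d := (_ + _) in p_def.
have d_size : size d = 3%N.
  by rewrite size_polyDl size_exp_XsubC // size_polyC; case: eqP.
have d_neq0 : d != 0 by rewrite -size_poly_eq0 d_size.
have q_neq0 : q != 0.
  by apply/eqP => q0; move: p_gt1; rewrite p_def q0 mul0r size_poly0.
have p_size : size p = (size q).+2 by rewrite p_def size_mul // d_size addn3.
(* The quadratic factor is positive away from [u]; at [u] it vanishes when v = 0, and continuity
   takes over. *)
have q_ge0' x : x != u -> 0 <= q.[x].
  rewrite -subr_eq0 => xu; have := p_ge0 x; rewrite p_def !hornerE.
  rewrite pmulr_lge0 // ltr_pwDl ?sqr_ge0 // ?exprn_even_gt0 //=.
have q_ge0 x : 0 <= q.[x].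
  have [->|/q_ge0'//] := eqVneq x u; apply: horner_ge0_limit => e e_gt0.
  exists (u + e / 2); first by rewrite addrAC subrr add0r gtr0_norm; lra.
  by apply: q_ge0'; rewrite gt_eqF // ltrDl divr_gt0.
have [|qs [qs_size q_def]] := IHk q _ q_ge0.
  by move: p_lek; rewrite p_size ltnS => /ltnW.
exists ([seq ('X - u%:P) * r | r <- qs] ++ [seq v%:P * r | r <- qs]); split.
  move=> r; rewrite mem_cat => /orP[]/mapP[r' /qs_size r'_size ->];
    (apply: (@leq_trans (size r').+1.*2); last by rewrite p_size doubleS !ltnS);
    rewrite leq_double (leq_trans (size_polyMleq _ _)) //.
    by rewrite size_XsubC.
  have := size_polyC_leq1 v.
  by case: (size v%:P) => [|[|]] // _; rewrite add0n (leq_trans (leq_pred _)).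
rewrite big_cat !big_map /= p_def q_def mulr_suml -big_split /=.
by apply: eq_bigr => r _; rewrite /d polyC_exp; ring.
Qed.

End UnivariateSumOfSquares.

(* The pair of Chebyshev polynomials (T_k, U_(k-1)) evaluated at x, with
   U_(-1) = 0. *)
Fixpoint chebyshev (A : comNzRingType) (x : A) (k : nat) : A * A :=
  if k is k'.+1 then
    let: (t, u) := chebyshev x k' in (x * t - (1 - x ^+ 2) * u, x * u + t)
  else (1, 0).

(** * Chebyshev polynomials and the univariate certificate *)

Section Chebyshev.

Lemma size_polyM_le (A : nzRingType) (p q : {poly A}) a b :
  (size p <= a.+1)%N -> (size q <= b)%N -> (size (p * q)%R <= a + b)%N.
Proof.
move=> p_size q_size; apply: leq_trans (size_polyMleq _ _) _.
by rewrite -subn1 leq_subLR add1n -addSn leq_add.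
Qed.

Lemma chebyshevS (A : comNzRingType) (x : A) k :
  chebyshev x k.+1 =
    (x * (chebyshev x k).1 - (1 - x ^+ 2) * (chebyshev x k).2,
     x * (chebyshev x k).2 + (chebyshev x k).1).
Proof. by rewrite /=; case: (chebyshev x k). Qed.

(** With w^2 = x^2 - 1, the recurrence multiplies T + U w by x + w, an element of norm x^2 - w^2 =
    1; the left-hand side is the norm of T + U w. *)
Lemma chebyshev_pell (A : comNzRingType) (x : A) k :
  (chebyshev x k).1 ^+ 2 + (1 - x ^+ 2) * (chebyshev x k).2 ^+ 2 = 1.
Proof.
elim: k => [|k IHk]; first by rewrite /= expr1n expr0n mulr0 addr0.
by rewrite chebyshevS /= -[RHS]IHk; ring.
Qed.

(** Applied to evaluation at a point, this reduces values of the Chebyshev polynomials to the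
    recurrence over the reals. *)
Lemma rmorph_chebyshev (A B : comNzRingType) (f : {rmorphism A -> B}) (x : A) k :
  chebyshev (f x) k = (f (chebyshev x k).1, f (chebyshev x k).2).
Proof.
elim: k => [|k IHk]; first by rewrite /= rmorph1 rmorph0.
rewrite !chebyshevS IHk /= rmorphB !rmorphD !rmorphM rmorphB rmorph1 rmorphXn //.
Qed.

Lemma chebyshev_ge1 (A : realDomainType) (x : A) k : 1 <= x ->
  1 <= (chebyshev x k).1 /\ k%:R <= (chebyshev x k).2.
Proof.
move=> x_ge1; elim: k => [|k [IHt IHu]] //; rewrite chebyshevS /= -natr1.
have k_ge0 : 0 <= k%:R :> A by apply: ler0n.
have x2u_ge0 : 0 <= (x ^+ 2 - 1) * (chebyshev x k).2.
  by apply: mulr_ge0; [rewrite subr_ge0 exprn_ege1 | apply: le_trans IHu].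
split; nra.
Qed.

(** Pell's equation bounds |T| by 1 on [-1, 1], so each step of the recurrence increases the bound
    on |U| by at most 1. *)
Lemma chebyshevU_norm_le (A : realDomainType) (x : A) k : `|x| <= 1 ->
  `|(chebyshev x k).2| <= k%:R.
Proof.
move=> x_le1; elim: k => [|k IHk]; first by rewrite normr0.
rewrite chebyshevS /= -natr1 (le_trans (ler_normD _ _)) // lerD //.
  by rewrite normrM -[leRHS]mul1r ler_pM.
have u2_ge0 : 0 <= (1 - x ^+ 2) * (chebyshev x k).2 ^+ 2.
  by apply: mulr_ge0; rewrite ?sqr_ge0 // subr_ge0 -real_normK ?num_real // exprn_ile1.
have := chebyshev_pell x k => pell.
by rewrite ler_norml; apply/andP; split; nra.
Qed.

Lemma size_chebyshev (A : comNzRingType) (x : {poly A}) k : (size x <= 2)%N ->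
  (size (chebyshev x k).1 <= k.+1)%N /\ (size (chebyshev x k).2 <= k)%N.
Proof.
move=> x_size; elim: k => [|k [IHt IHu]].
  by rewrite /= size_poly1 size_poly0.
have x2_size : (size (1 - x ^+ 2)%R <= 3)%N.
  rewrite (leq_trans (size_polyD _ _)) // size_poly1 geq_max /= size_polyN expr2.
  exact: (@size_polyM_le _ _ _ 1 2).
rewrite chebyshevS /=; split; rewrite (leq_trans (size_polyD _ _)) // geq_max;
  apply/andP; split=> //; rewrite ?size_polyN.
- exact: (@size_polyM_le _ _ _ 1 k.+1).
- exact: (@size_polyM_le _ _ _ 2 k).
- exact: (@size_polyM_le _ _ _ 1 k).
Qed.

Variable R : realType.

(* The damping polynomial is U_(m-1)(1 - t/n) / m: Pell's equation bounds
   t G(t)^2 by n/m^2. *)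
Lemma damping_poly (n m : nat) : (0 < n)%N -> (0 < m)%N -> (n <= m ^ 2)%N ->
  exists G : {poly R},
    [/\ (size G <= m)%N,
        forall t, t <= 0 -> 1 <= G.[t],
        forall t, 0 <= t <= n%:R -> `|G.[t]| <= 1
      & forall t, 0 <= t <= n%:R -> t * G.[t] ^+ 2 <= 1].
Proof.
move=> n_gt0 m_gt0 n_le_m2.
have nR_gt0 : 0 < n%:R :> R by rewrite ltr0n.
have mR_gt0 : 0 < m%:R :> R by rewrite ltr0n.
pose x : {poly R} := 1 - n%:R^-1 *: 'X.
have x_size : (size x <= 2)%N.
  rewrite (leq_trans (size_polyD _ _)) // size_poly1 geq_max /= size_polyN.
  by rewrite (leq_trans (size_scale_leq _ _)) // size_polyX.
pose U t : R := (chebyshev (1 - t / n%:R) m).2.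
exists (m%:R^-1 *: (chebyshev x m).2).
have GE t : (m%:R^-1 *: (chebyshev x m).2).[t] = U t / m%:R.
  rewrite hornerZ mulrC; congr (_ * _); rewrite /U.
  have <- : horner_eval t x = 1 - t / n%:R.
    by rewrite /horner_eval /x !hornerE mulrC.
  by rewrite rmorph_chebyshev.
have t_unit (t : R) : 0 <= t <= n%:R -> 0 <= t / n%:R <= 1.
  move=> /andP[t0 tn]; apply/andP; split; first by apply: divr_ge0 => //; apply: ltW.
  by rewrite ler_pdivrMr // mul1r.
split=> [|t t_le0|t /t_unit/andP[s0 s1]|t /t_unit/andP[s0 s1]].
- by rewrite (leq_trans (size_scale_leq _ _)) //; have [] := size_chebyshev m x_size.
- rewrite GE ler_pdivlMr // mul1r.
  have s_le0 : t / n%:R <= 0 by rewrite pmulr_lle0 ?invr_gt0.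
  by have [] := @chebyshev_ge1 _ (1 - t / n%:R) m _; first by lra.
- rewrite GE normrM [`|_^-1|]gtr0_norm ?invr_gt0 // ler_pdivrMr // mul1r.
  by apply: chebyshevU_norm_le; rewrite ler_norml; apply/andP; split; lra.
- have nm : n%:R <= m%:R ^+ 2 :> R by rewrite -natrX ler_nat.
  rewrite GE expr_div_n mulrA ler_pdivrMr ?exprn_gt0 // mul1r.
  apply: le_trans nm.
  (* For s = t/n in [0, 1], 1 - (1 - s)^2 = s (2 - s) >= s, so Pell's equation gives s U^2 <= 1. *)
  have tE : t = t / n%:R * n%:R by rewrite divfK ?gt_eqF.
  have := chebyshev_pell (1 - t / n%:R) m; rewrite -/(U t) => pell.
  rewrite [X in X * _]tE mulrAC ger_pMl //.
  have := sqr_ge0 (U t); have := sqr_ge0 (chebyshev (1 - t / n%:R) m).1; nra.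
Qed.

(* With h = G^2 / sqrt (2 n) and Q the second summand, t (1 - Q(t)) is
   nonnegative on the whole real line, not only on [0, n]. *)
Lemma univariate_certificate (n m : nat) :
  (1 < n)%N -> (0 < m)%N -> (n <= m ^ 2)%N ->
  exists (rs : seq {poly R}) (h : {poly R}),
    [/\ forall r, r \in rs -> (size r <= 2 * m)%N,
        (size h <= (2 * m).-1)%N
      & 'X * (\sum_(r <- rs) r ^+ 2)
        + ('X - 1) * ('X - 2) * (n%:R - 'X) * h ^+ 2 = 1].
Proof.
move=> n_gt1 m_gt0 n_le_m2.
have [G [G_size G_ge1 G_le1 G_damp]] := damping_poly (ltnW n_gt1) m_gt0 n_le_m2.
have n_ge2 : 2 <= n%:R :> R by rewrite ler_nat.
have n2_gt0 : 0 < (2 * n)%:R :> R by rewrite ltr0n; lia.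
(* The cubic equals 2n at 0, where G = 1; this scaling makes [Q] equal to 1 there. *)
pose h := (Num.sqrt (2 * n)%:R)^-1 *: G ^+ 2.
have h_size : (size h <= (2 * m).-1)%N.
  rewrite (leq_trans (size_scale_leq _ _)) // expr2.
  have -> : (2 * m).-1 = (m.-1 + m)%N by lia.
  by apply: size_polyM_le; rewrite ?prednK.
have hE t : h.[t] ^+ 2 = G.[t] ^+ 4 / (2 * n)%:R.
  by rewrite hornerZ horner_exp exprMn exprVn sqr_sqrtr ?ltW // mulrC -exprM.
pose Q : {poly R} := ('X - 1) * ('X - 2) * (n%:R - 'X) * h ^+ 2.
pose K (t : R) := (t - 1) * (t - 2) * (n%:R - t) / (2 * n)%:R.
have QE t : Q.[t] = K t * G.[t] ^+ 4.
  have -> : Q = ('X - 1%:P) * ('X - 2%:P) * (n%:R%:P - 'X) * h ^+ 2.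
    by rewrite /Q !polyC_natr.
  by rewrite hornerM horner_exp hE !hornerM !hornerD !hornerN !hornerX !hornerC /K; ring.
have K_le (t c : R) : (t - 1) * (t - 2) * (n%:R - t) <= c * (2 * n)%:R -> K t <= c.
  by rewrite /K ler_pdivrMr.
have K_ge1 (t : R) : t <= 0 -> 1 <= K t.
  move=> t_le0; rewrite /K ler_pdivlMr // mul1r natrM.
  have : 2 <= (1 - t) * (2 - t) by nra.
  nra.
have XQ_ge0 t : 0 <= ('X * (1 - Q)).[t].
  rewrite hornerM hornerX hornerD hornerN hornerC QE.
  have [t_le0|t_gt0] := leP t 0.
    have G4_ge1 : 1 <= G.[t] ^+ 4 by apply: exprn_ege1; apply: G_ge1.
    by apply: mulr_le0 => //; rewrite subr_le0; apply: mulr_ege1 => //; apply: K_ge1.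
  rewrite pmulr_rge0 // subr_ge0.
  have G4_ge0 : 0 <= G.[t] ^+ 4 by apply: exprn_even_ge0.
  (* This settles t > n and 1 <= t < 2, where the cubic is nonpositive. *)
  have K_le0 : (t - 1) * (t - 2) * (n%:R - t) <= 0 -> K t * G.[t] ^+ 4 <= 1.
    move=> K_le0; apply: le_trans ler01; apply: mulr_le0_ge0 => //.
    by apply: K_le; rewrite mul0r.
  have [t_len|t_gtn] := leP t n%:R; last first.
    apply: K_le0; apply: mulr_ge0_le0; last by lra.
    by apply: mulr_ge0; lra.
  have t_itv : 0 <= t <= n%:R by rewrite ltW.
  (* On [2, n], K <= t^2, and the damping bound t G^2 <= 1 is squared. *)
  have [t_ge2|t_lt2] := leP 2 t.
    have Kt : K t <= t ^+ 2.
      apply: K_le; rewrite natrM.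
      have : (t - 1) * (t - 2) <= t ^+ 2 by nra.
      have : 0 <= (t - 1) * (t - 2) by nra.
      have := sqr_ge0 t; nra.
    apply: le_trans (ler_wpM2r G4_ge0 Kt) _.
    have -> : t ^+ 2 * G.[t] ^+ 4 = (t * G.[t] ^+ 2) ^+ 2 by ring.
    apply: exprn_ile1; last exact: G_damp.
    by apply: mulr_ge0; [apply: ltW | apply: sqr_ge0].
  have [t_ge1|t_lt1] := leP 1 t.
    apply: K_le0; apply: mulr_le0_ge0; last by lra.
    by apply: mulr_ge0_le0; lra.
  (* For 0 < t < 1 the cubic is at most 2n, so both [K] and G^4 are at most 1. *)
  have G4_le1 : G.[t] ^+ 4 <= 1.
    have -> : G.[t] ^+ 4 = `|G.[t]| ^+ 4.
      by rewrite -normrX ger0_norm.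
    by apply: exprn_ile1; [apply: normr_ge0 | apply: G_le1].
  have : K t <= 1.
    apply: K_le; rewrite natrM.
    have : (1 - t) * (2 - t) <= 2 by nra.
    have : 0 <= (1 - t) * (2 - t) by nra.
    nra.
  nra.
have [qs [qs_size qs_sum]] := ge0_poly_sum_squares XQ_ge0.
(* The sum of squares 'X (1 - Q) vanishes at 0, hence so does each term. Dividing every [q] by 'X
   gives 1 - Q = 'X times a sum of squares. *)
have qs_root q : q \in qs -> root q 0.
  move=> q_qs; have := congr1 (horner^~ 0) qs_sum.
  rewrite hornerM hornerX mul0r horner_sum => /esym/eqP.
  rewrite psumr_eq0 => [/allP/(_ q q_qs)|r _]; rewrite horner_exp ?sqr_ge0 //.
  by rewrite implyTb sqrf_eq0.
have qs_div q : q \in qs -> q %/ 'X * 'X = q.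
  by move=> q_qs; rewrite divpK // -['X]subr0 -polyC0 -root_factor_theorem qs_root.
exists [seq q %/ 'X | q <- qs], h; split=> //.
  move=> r /mapP[q q_qs ->]; rewrite size_divp ?polyX_eq0 // size_polyX.
  have lin_size (p : {poly R}) : size p = 1%N -> (size ('X - p)%R <= 2)%N.
    by move=> p1; rewrite size_polyDl size_polyX ?size_polyN ?p1.
  (* The degree of [Q] is at most 3 + 2 (2m - 2) = 4m - 1, so each [q] has degree at most 2m, and
     its quotient by 'X at most 2m - 1. *)
  have Q_size : (size Q <= 4 * m)%N.
    have -> : (4 * m = 1 + 1 + 1 + ((2 * m).-2 + (2 * m).-1))%N by lia.
    apply: size_polyM_le; last first.
      have h_size' : (size h <= (2 * m).-2.+1)%N by rewrite (leq_trans h_size) //; lia.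
      by rewrite expr2; apply: size_polyM_le.
    apply: (@size_polyM_le _ _ _ 2 2); last first.
      by rewrite -opprB size_polyN lin_size // -polyC_natr size_polyC pnatr_eq0 -lt0n ltnW.
    apply: (@size_polyM_le _ _ _ 1 2); apply: lin_size; first by rewrite size_poly1.
    by rewrite -polyC_natr size_polyC pnatr_eq0.
  have XQ_size : (size ('X * (1 - Q))%R <= 1 + 4 * m)%N.
    apply: size_polyM_le; first by rewrite size_polyX.
    rewrite (leq_trans (size_polyD _ _)) // geq_max size_poly1 size_polyN Q_size.
    by lia.
  move: XQ_size (qs_size _ q_qs); move: (size ('X * (1 - Q))%R) (size q) => a b /=.
  by lia.
apply: (mulfI (negbT (polyX_eq0 R))); rewrite mulr1 mulrDr -/Q.
rewrite mulrA -expr2 big_map mulr_sumr.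
under eq_big_seq => q q_qs do rewrite mulrC -exprMn qs_div //.
by rewrite -qs_sum; ring.
Qed.

End Chebyshev.

(** * Degree bounds, closure and soundness of SoS certificates *)

Section SumOfSquaresCone.
Variables (R : realType) (n : nat).
Implicit Types (p q s L A : {mpoly R[n]}) (G : seq {mpoly R[n]}).

Lemma msizeM_leS p q a b :
  (msize p <= a.+1)%N -> (msize q <= b.+1)%N -> (msize (p * q)%R <= (a + b).+1)%N.
Proof.
move=> p_size q_size; have [->|p_neq0] := eqVneq p 0; first by rewrite mul0r msize0.
have [->|q_neq0] := eqVneq q 0; first by rewrite mulr0 msize0.
by rewrite msizeM // -subn1 leq_subLR add1n -addSn -addnS leq_add.
Qed.

Lemma msizeD_leS p q a : (msize p <= a)%N -> (msize q <= a)%N -> (msize (p + q)%R <= a)%N.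
Proof. by move=> pa qa; rewrite (leq_trans (msizeD_le _ _)) // geq_max pa. Qed.

Lemma msizeB_leS p q a : (msize p <= a)%N -> (msize q <= a)%N -> (msize (p - q)%R <= a)%N.
Proof. by move=> pa qa; apply: msizeD_leS; rewrite ?mmeasureN. Qed.

(** Each Horner step multiplies by [p], of degree at most 1. A zero partial result is treated apart,
    since its size is not a degree plus one. *)
Lemma msize_horner_alg p (r : {poly R}) :
  (msize p <= 2)%N -> (msize (horner_alg p r) <= size r)%N.
Proof.
move=> p_size; elim/poly_ind: r => [|r c IHr]; first by rewrite rmorph0 msize0.
rewrite rmorphD rmorphM /= horner_algX horner_algC size_MXaddC.
have [->|r_neq0] := eqVneq r 0.
  rewrite rmorph0 mul0r add0r; have [->|_] /= := eqVneq c 0.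
    by rewrite scale0r msize0.
  by rewrite (leq_trans (msizeZ_le _ _)) // msize1.
move: IHr; rewrite /=; case: (size r) (size_poly_eq0 r) => [|k _ IHr].
  by rewrite eqxx (negPf r_neq0).
apply: msizeD_leS; first by rewrite -addn1; apply: msizeM_leS.
by rewrite (leq_trans (msizeZ_le _ _)) // msize1.
Qed.

Lemma in_Sigma0 d : in_Sigma d (0 : {mpoly R[n]}).
Proof. by exists [::]; rewrite big_nil. Qed.

Lemma in_SigmaD d p q : in_Sigma d p -> in_Sigma d q -> in_Sigma d (p + q).
Proof.
move=> [ps [ps_size ->]] [qs [qs_size ->]]; exists (ps ++ qs).
split=> [r|]; last by rewrite big_cat.
by rewrite mem_cat => /orP[/ps_size|/qs_size].
Qed.

Lemma in_Sigma_sqrM d k L A :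
  (msize L <= k.+1)%N -> in_Sigma d A -> in_Sigma (k + d) (L ^+ 2 * A).
Proof.
move=> L_size [qs [qs_size ->]]; exists [seq L * q | q <- qs].
split=> [r /mapP[q /qs_size q_size ->]|]; first exact: msizeM_leS.
by rewrite big_map mulr_sumr; apply: eq_bigr => q _; rewrite exprMn.
Qed.

Lemma meval_in_Sigma d p (x : 'I_n -> R) : in_Sigma d p -> 0 <= p.@[x].
Proof.
move=> [qs [_ ->]]; rewrite raddf_sum sumr_ge0 // => q _.
by rewrite /= rmorphXn sqr_ge0.
Qed.

(** Soundness of certificates: it yields the lower bound on the objective and, at an optimal point,
    the upper bound on every certified value. *)
Lemma meval_in_SigmaG G d p (x : 'I_n -> R) :
  in_SigmaG G d p -> feasible G x -> 0 <= p.@[x].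
Proof.
move=> [s0 [sg [s0_sos sg_sos ->]]] Gx.
rewrite mevalD (raddf_sum (meval x)) addr_ge0 ?(meval_in_Sigma _ s0_sos) //.
rewrite big_seq sumr_ge0 // => t /sg_sos[t1_sos t2_G].
by rewrite /= mevalM mulr_ge0 ?(meval_in_Sigma _ t1_sos) // Gx.
Qed.

Lemma in_SigmaG0 G d : in_SigmaG G d 0.
Proof.
by exists 0, [::]; split=> //; [apply: in_Sigma0 | rewrite big_nil addr0].
Qed.

Lemma in_SigmaGD G d p q : in_SigmaG G d p -> in_SigmaG G d q -> in_SigmaG G d (p + q).
Proof.
move=> [s0 [sg [s0_sos sg_sos ->]]] [t0 [tg [t0_sos tg_sos ->]]].
exists (s0 + t0), (sg ++ tg); split; first exact: in_SigmaD.
  by move=> t; rewrite mem_cat => /orP[/sg_sos|/tg_sos].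
by rewrite big_cat /= addrACA.
Qed.

Lemma in_SigmaG_sum (I : Type) (r : seq I) (F : I -> {mpoly R[n]}) G d :
  (forall i, in_SigmaG G d (F i)) -> in_SigmaG G d (\sum_(i <- r) F i).
Proof.
move=> F_sos; elim/big_rec: _ => [|i p _]; first exact: in_SigmaG0.
exact: in_SigmaGD.
Qed.

Lemma in_SigmaG_mul G d s g : g \in G -> in_Sigma d s -> in_SigmaG G d (s * g).
Proof.
move=> gG s_sos; exists 0, [:: (s, g)]; split; first exact: in_Sigma0.
  by move=> t; rewrite inE => /eqP->.
by rewrite big_seq1 add0r.
Qed.

(* L = ((L + 1) / 2)^2 - ((L - 1) / 2)^2. *)
Lemma in_SigmaG_equation G d L A g :
  g \in G -> - g \in G -> (msize L <= 2)%N -> in_Sigma d A ->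
  in_SigmaG G d.+1 (L * A * g).
Proof.
move=> gG NgG L_size A_sos.
have half_size c : (msize (2^-1 *: (L + c%:MP)) <= 2)%N.
  rewrite (leq_trans (msizeZ_le _ _)) // msizeD_leS // msizeC; by case: eqP.
have -> : L * A * g = (2^-1 *: (L + 1%:MP)) ^+ 2 * A * g
                      + (2^-1 *: (L + (-1)%:MP)) ^+ 2 * A * - g.
  have -> : L * A * g = 4^-1 *: (4 *: (L * A * g)).
    by rewrite scalerA mulVf ?scale1r ?pnatr_eq0.
  rewrite !exprZn mpolyC1 mpolyCN mpolyC1 -!scalerAl -!scalerDr.
  have -> : 2^-1 ^+ 2 = 4^-1 :> R by field.
  congr (_ *: _); rewrite scaler_nat; ring.
by apply: in_SigmaGD; apply: in_SigmaG_mul => //; apply: (@in_Sigma_sqrM d 1).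
Qed.

End SumOfSquaresCone.

(** * The Set Cover instance: certificate and optimal value *)

Section SetCover.
Variables (R : realType) (n : nat).

Lemma set_cover_certificate (m : nat) :
  (1 < n)%N -> (0 < m)%N -> (n <= m ^ 2)%N ->
  in_SigmaG (set_cover_constraints R n) (2 * m)
    (set_cover_objective R n - 2%:MP).
Proof.
move=> n_gt1 m_gt0 n_le_m2.
have [rs [h [rs_size h_size cert]]] := univariate_certificate R n_gt1 m_gt0 n_le_m2.
set G := set_cover_constraints R n; set S := set_cover_objective R n.
pose phi := horner_alg S.
pose A := \sum_(r <- rs) phi r ^+ 2.
pose B := (S - 2) ^+ 2 * phi h ^+ 2.
have X_size (j : 'I_n) : (msize ('X_j : {mpoly R[n]}) <= 2)%N by rewrite msizeX mdeg1.
have S_size : (msize S <= 2)%N.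
  rewrite /S /set_cover_objective; elim/big_rec: _ => [|i p _ p_size].
    by rewrite msize0.
  exact: msizeD_leS.
have C_size (k : nat) : (msize (k%:R : {mpoly R[n]}) <= 2)%N.
  by rewrite -mpolyC_nat msizeC; case: eqP.
(* The squares in [A] and [B] are of polynomials of degree at most d = 2m - 1, which leaves room for
   one affine factor. *)
have [d dE] : exists d, (2 * m)%N = d.+1 by exists (2 * m).-1; lia.
have A_sos : in_Sigma d A.
  exists [seq phi r | r <- rs]; split; last by rewrite big_map.
  move=> q /mapP[r /rs_size r_size ->]; rewrite -dE.
  by rewrite (leq_trans (msize_horner_alg _ S_size)).
have B_sos : in_Sigma d B.
  have -> : d = (1 + d.-1)%N by lia.
  apply: in_Sigma_sqrM; first by apply: msizeB_leS => //; apply: (C_size 2).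
  exists [:: phi h]; split; last by rewrite big_seq1.
  move=> q; rewrite inE => /eqP->; rewrite (leq_trans (msize_horner_alg _ S_size)) //.
  by move: h_size; rewrite dE; lia.
have certS : S * A + (S - 1) * (S - 2) * (n%:R - S) * phi h ^+ 2 = 1.
  have := congr1 (horner_alg S) cert.
  rewrite !(rmorph1, rmorphD, rmorphM, rmorphN, rmorph_nat, rmorphXn, rmorph_sum) /=.
  rewrite horner_algX => certE; rewrite -[RHS]certE; congr (_ * _ + _).
  by apply: eq_bigr => r _; rewrite rmorphXn.
pose g (j : 'I_n) : {mpoly R[n]} := \sum_(i < n | i != j) 'X_i - 1.
pose delta (j : 'I_n) : {mpoly R[n]} := 'X_j ^+ 2 - 'X_j.
have gE j : g j = S - 'X_j - 1.
  by congr (_ - 1); rewrite /S /set_cover_objective [in RHS](bigD1 j) //= addrAC subrr add0r.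
have delta_G j : delta j \in G.
  by rewrite !mem_cat map_f ?mem_enum.
have Ndelta_G j : - delta j \in G.
  rewrite !mem_cat (map_f (fun j => - delta j)) ?orbT ?mem_enum //.
have g_G j : g j \in G.
  by rewrite !mem_cat (map_f g) ?orbT ?mem_enum.
(* Modulo [delta j], 'X_j g_j = 'X_j (S - 2) and (1 - 'X_j) g_j = (1 - 'X_j) (S - 1); the multiples
   of [delta j] make this exact. Summing over j turns 'X_j into S and 1 - 'X_j into n - S, and
   [certS] finishes. *)
have -> : S - 2%:MP = \sum_(j < n)
    (('X_j ^+ 2 * A + (1 - 'X_j) ^+ 2 * B) * g j
     + ('X_j + 2 - S) * A * delta j + ('X_j - S) * B * delta j).
  transitivity (\sum_(j < n) ('X_j * ((S - 2) * A) + (1 - 'X_j) * ((S - 1) * B))).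
    rewrite big_split /= -!mulr_suml sumrB sumr_const card_ord.
    rewrite -/(set_cover_objective R n) -/S.
    transitivity ((S - 2) * (S * A + (S - 1) * (S - 2) * (n%:R - S) * phi h ^+ 2)).
      by rewrite certS mulr1 mpolyC_nat.
    by rewrite /B; ring.
  by apply: eq_bigr => j _; rewrite gE /delta; ring.
apply: in_SigmaG_sum => j; rewrite dE; do !apply: in_SigmaGD.
- apply: in_SigmaG_mul => //; apply: in_SigmaD; apply: (@in_Sigma_sqrM _ _ d 1) => //.
  by apply: msizeB_leS => //; apply: (C_size 1).
- apply: in_SigmaG_equation => //; apply: msizeB_leS => //.
  by apply: msizeD_leS => //; apply: (C_size 2).
- by apply: in_SigmaG_equation => //; apply: msizeB_leS.
Qed.

(** The indicator of two indices works: omitting one coordinate lowers the total 2 by at most 1. *)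
Lemma set_cover_attains2 : (1 < n)%N ->
  exists2 x : 'I_n -> R, feasible (set_cover_constraints R n) x
    & (set_cover_objective R n).@[x] = 2.
Proof.
move=> n_gt1.
pose i0 : 'I_n := Ordinal (ltnW n_gt1); pose i1 : 'I_n := Ordinal n_gt1.
pose x (i : 'I_n) : R := ((i == i0) || (i == i1))%:R.
have i10 : i1 != i0 by [].
have x_sqr i : x i ^+ 2 - x i = 0 by rewrite /x; case: orb; rewrite ?expr1n ?expr0n subrr.
have x_ge0 i : 0 <= x i by rewrite ler0n.
have sum_x : \sum_(i < n) x i = 2.
  rewrite (bigD1 i0) //= (bigD1 i1) //= big1 ?addr0 /x ?eqxx ?orbT // => i.
  by move=> /andP[/negPf-> /negPf->].
have deltaE j : ('X_j ^+ 2 - 'X_j : {mpoly R[n]}).@[x] = 0.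
  by rewrite mevalB rmorphXn /= mevalXU x_sqr.
exists x; last first.
  by rewrite raddf_sum -sum_x; apply: eq_bigr => i _; rewrite /= mevalXU.
move=> g; rewrite !mem_cat => /orP[/orP[]|] /mapP[j _ ->].
- by rewrite deltaE.
- by rewrite mevalN deltaE oppr0.
rewrite mevalB meval1 raddf_sum /= (eq_bigr x) => [|i _]; last exact: mevalXU.
have := sum_x; rewrite (bigD1 j) //= => sum_j.
have : x j <= 1 by rewrite lern1 leq_b1.
lra.
Qed.

(** The certificate bounds the objective below by 2, and the feasible point of value 2 caps both
    optima. *)
Lemma set_cover_sos_exact d :
  (1 < n)%N ->
  in_SigmaG (set_cover_constraints R n) d (set_cover_objective R n - 2%:MP) ->
  sos_exact (set_cover_objective R n) (set_cover_constraints R n) d.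
Proof.
move=> n_gt1 cert; have [x x_feas fx] := set_cover_attains2 n_gt1.
exists 2; split=> //.
- by exists x.
- move=> w [y y_feas ->].
  by have := meval_in_SigmaG cert y_feas; rewrite mevalB mevalC subr_ge0.
- move=> w /meval_in_SigmaG/(_ x_feas).
  by rewrite mevalB mevalC fx subr_ge0.
Qed.

End SetCover.

(** * Existence of the SoS rank and its bound *)

Lemma is_sos_rank_le (R : realType) (n : nat) (f : {mpoly R[n]}) G d :
  sos_exact f G d -> exists2 r, is_sos_rank f G r & (r <= d)%N.
Proof.
move=> exact_d.
(* Classical reflection makes exactness boolean, as [ex_minnP] requires. *)
have exP : exists k, boolp.asbool (sos_exact f G k) by exists d; apply/boolp.asboolP.
case: (ex_minnP exP) => r /boolp.asboolP exact_r r_min.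
exists r; last by apply: r_min; apply/boolp.asboolP.
by split=> // k exact_k; apply: r_min; apply/boolp.asboolP.
Qed.

Theorem theorem3 (R : realType) :
  exists2 C : R, 0 < C &
    forall n : nat, (2 <= n)%N ->
      exists2 r : nat,
        is_sos_rank (set_cover_objective R n) (set_cover_constraints R n) r
        & r%:R <= C * Num.sqrt (n%:R : R) * exp.ln (n%:R : R).
Proof.
have ln2_gt0 : 0 < exp.ln (2 : R) by apply: exp.ln_gt0; rewrite ltr1n.
(* The certificate has level 2m with m <= sqrt n + 1 <= 2 sqrt n, so the rank is at most 4 sqrt n;
   dividing by ln 2 <= ln n accommodates the logarithm. *)
exists (4 / exp.ln 2); first by apply: divr_gt0.
move=> n n_gt1; set s := Num.sqrt n%:R.
have s_ge1 : 1 <= s by rewrite -[leLHS]sqrtr1 ler_wsqrtr // ler1n ltnW.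
have s_sqr : s ^+ 2 = n%:R by rewrite sqr_sqrtr ?ler0n.
have s_ge0 := le_trans ler01 s_ge1.
have /andP[m_le m_gt] := Num.Theory.truncn_itv s_ge0.
set m := (Num.truncn s).+1 in m_gt.
have n_le_m2 : (n <= m ^ 2)%N.
  by rewrite -(ler_nat R) natrX -s_sqr ler_sqr ?nnegrE ?ler0n // ltW.
have cert := set_cover_certificate R n_gt1 (ltn0Sn _) n_le_m2.
have [r r_rank r_le] := is_sos_rank_le (set_cover_sos_exact n_gt1 cert).
exists r => //.
have ln_le : exp.ln 2 <= exp.ln (n%:R : R).
  by rewrite exp.ler_ln ?posrE ?ltr0n ?ler_nat // ltnW.
have r_le4s : r%:R <= 4 * s.
  apply: (@le_trans _ _ (2 * m)%:R); first by rewrite ler_nat.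
  by rewrite natrM /m -natr1; lra.
apply: le_trans r_le4s _; rewrite -!mulrA ler_wpM2l //.
by rewrite ler_pdivlMl // mulrC ler_wpM2l.
Qed.
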